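(* Let $n,\ell$ be positive integers and let $A_1,\dots,A_\ell\in\mathcal{H}_n$. Then for every unitarily invariant norm $|||\cdot|||$ on $\mathcal{M}_n$, $$\left|\left|\left|\;\left|\sum_{i=1}^{\ell}A_i\right|^r\;\right|\right|\right|\leq\left|\left|\left|\;\sum_{i=1}^{\ell}p_i^{-1}|A_i|^r\;\right|\right|\right|$$ for all real $r$ with $1<r\leq 2$ and all real numbers $0<p_1,\dots,p_\ell\leq 1$ with $\sum_{i=1}^{\ell}p_i=1$.
   Context: $\mathcal{M}_n$ denotes the $C^*$-algebra of $n\times n$ complex matrices and $\mathcal{H}_n$ the set of Hermitian matrices in $\mathcal{M}_n$. A norm $|||\cdot|||$ on $\mathcal{M}_n$ is unitarily invariant if $|||UAV|||=|||A|||$ for all $A\in\mathcal{M}_n$ and all unitary $U,V\in\mathcal{M}_n$. $|A|=(A^*A)^{1/2}$, and powers of positive semidefinite matrices are defined by the functional calculus. *)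

(* Defs.v *)
From mathcomp Require Export all_boot all_order all_algebra complex.
From mathcomp Require Export reals exp.

Set Implicit Arguments.
Unset Strict Implicit.
Unset Printing Implicit Defensive.

Import Order.TTheory GRing.Theory Num.Theory.

Local Open Scope ring_scope.
Local Open Scope complex_scope.
Local Open Scope sesquilinear_scope.

(* [spectralmx A] is unitary and, for normal [A],
   [A = invmx (spectralmx A) *m diag_mx (spectral_diag A) *m spectralmx A].
   The value is meaningful only for Hermitian [A], whose eigenvalues are real,
   so that [Re] loses nothing. *)
Definition mxfun (R : realType) (n : nat) (f : R -> R) (A : 'M[R[i]]_n) :
    'M[R[i]]_n :=
  invmx (spectralmx A) *m
  diag_mx (\row_(j < n) (f (complex.Re (spectral_diag A 0 j)))%:C) *m
  spectralmx A.

(* [mxfun f A] does not depend on the diagonalization chosen by [spectralmx]. *)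
Lemma mxfunE (R : realType) (n : nat) (f : R -> R) (U : 'M[R[i]]_n)
    (d : 'rV[R]_n) :
  U \is unitarymx ->
  mxfun f (U ^t* *m diag_mx (\row_j (d 0 j)%:C) *m U) =
  U ^t* *m diag_mx (\row_j (f (d 0 j))%:C) *m U.
Proof.
move=> Uu; set D := \row_j (d 0 j)%:C; set A := _ *m U.
have UtU : U ^t* *m U = 1%:M.
  by rewrite -invmx_unitary ?mulVmx ?unitarymx_unit.
have Anormal : A \is normalmx.
  have At : A ^t* = A.
    rewrite /A !trmx_mul !map_mxM /= trmxCK mulmxA; congr (_ *m _ *m _).
    apply/matrixP => i j; rewrite !mxE eq_sym.
    case: eqP => [->|_]; last by rewrite !mulr0n rmorph0.
    by rewrite !mulr1n; apply/CrealP; rewrite complex_real.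
  by apply/normalmxP; rewrite At.
have Wunit := spectral_unit A; have spA := orthomx_spectralP Anormal.
rewrite /mxfun; set W := spectralmx A in Wunit spA *.
set E := spectral_diag A in spA *; pose P := W *m U ^t*.
have comm : diag_mx E *m P = P *m diag_mx D.
  have -> : diag_mx E *m P = W *m A *m U ^t*.
    by rewrite [in RHS]spA /P !mulmxA mulmxV // mul1mx.
  by rewrite /A /P -!mulmxA (unitarymxP Uu) mulmx1.
have commf : diag_mx (\row_j (f (complex.Re (E 0 j)))%:C) *m P =
             P *m diag_mx (\row_j (f (d 0 j))%:C).
  clearbody P; apply/matrixP => i j; move/matrixP: comm => /(_ i j).
  rewrite !mul_diag_mx !mul_mx_diag !mxE [RHS]mulrC => /eqP.
  have [->|Pn0] := eqVneq (P i j) 0; first by rewrite !mulr0 mul0r.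
  rewrite (inj_eq (mulIf Pn0)) => /eqP ->.
  by rewrite /= mulrC.
have WP : W = P *m U by rewrite /P -mulmxA UtU mulmx1.
rewrite -mulmxA [X in _ *m (_ *m X)]WP [X in _ *m X]mulmxA commf /P -!mulmxA.
by rewrite mulKmx.
Qed.

(* Meaningful for positive semidefinite [A] only; [0 `^ r = 0] for [r != 0]. *)
Definition mxpowR (R : realType) (n : nat) (A : 'M[R[i]]_n) (r : R) :
    'M[R[i]]_n :=
  mxfun (fun x : R => powR x r) A.

Definition mxabs (R : realType) (n : nat) (A : 'M[R[i]]_n) : 'M[R[i]]_n :=
  mxpowR (A ^t* *m A) 2^-1.

Definition is_norm (R : realType) (n : nat) (N : 'M[R[i]]_n -> R) : Prop :=
  [/\ forall A, 0 <= N A,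
      forall A, N A = 0 -> A = 0,
      forall (a : R[i]) A, N (a *: A) = Normc.normc a * N A &
      forall A B, N (A + B) <= N A + N B].

Definition unitarily_invariant (R : realType) (n : nat)
    (N : 'M[R[i]]_n -> R) : Prop :=
  forall A U V : 'M[R[i]]_n,
    U \is unitarymx -> V \is unitarymx -> N (U *m A *m V) = N A.

(* Main.v *)
Require Import Defs.
From mathcomp Require Import all_boot all_order all_algebra complex.
From mathcomp Require Import reals exp.
From mathcomp Require Import ring lra.

Set Implicit Arguments.
Unset Strict Implicit.
Unset Printing Implicit Defensive.

Import Order.TTheory GRing.Theory Num.Theory.

Local Open Scope ring_scope.
Local Open Scope complex_scope.
Local Open Scope sesquilinear_scope.

(** The inequality is decided by diagonal entries in one orthonormal basis.
    Let [u_j] be an eigenbasis of [H = \sum_i A_i], with eigenvalues [ev_j], and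
    let [K] be the matrix on the right-hand side.  Expanding each [A_i] in its
    own eigenbasis gives [<u_j, A_i u_j> = \sum_k w_ijk d_ik], where the [d_ik]
    are the eigenvalues of [A_i] and the [w_ijk] (squared moduli of the entries
    of a unitary matrix) are nonnegative with [\sum_k w_ijk = 1]; the same
    weights give [<u_j, |A_i|^r u_j> = \sum_k w_ijk |d_ik|^r]
    ([diag_entry_spectral_weights]).  So [ev_j = \sum_(i, k) w_ijk d_ik], and
    Jensen's inequality for [x |-> |x|^r], with the weights [p_i w_ijk] at the
    points [d_ik / p_i], yields

      [|ev_j|^r <= \sum_i p_i^(1 - r) \sum_k w_ijk |d_ik|^r <= <u_j, K u_j>],

    the last step because [p_i <= 1] and [r <= 2] ([weighted_jensen_powR]).

    Hence [|H|^r] is diagonal in the basis [u_j], with nonnegative entries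
    dominated by the diagonal entries of [K].  This suffices for every
    unitarily invariant norm ([norm_diag_le]): averaging a matrix with its
    conjugates by sign reflections erases the off-diagonal entries
    ([norm_pinching]), and multiplying a row by [t] in [[-1, 1]] is a convex
    combination of doing nothing and changing the sign of that row
    ([norm_scale_rows]); neither operation increases the norm. *)

(** * Jensen's inequality for powers *)

(** With [m] the mean of the [|x_i|], Young's inequality gives
    [|x_i| m^(r-1) <= |x_i|^r / r + m^r (1 - 1/r)], the tangent line bound at
    [m]; averaging it leaves [m^r <= \sum_i q_i |x_i|^r]. *)
Lemma jensen_powR (R : realType) (I : finType) (q x : I -> R) (r : R) :
  1 < r -> (forall i, 0 <= q i) -> \sum_i q i = 1 ->
  `|\sum_i q i * x i| `^ r <= \sum_i q i * `|x i| `^ r.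
Proof.
move=> r1 q0 q1; set m := \sum_i q i * `|x i|.
have r0 : 0 < r by lra.
have m0 : 0 <= m by apply: sumr_ge0 => i _; rewrite mulr_ge0.
apply: (@le_trans _ _ (m `^ r)).
  rewrite ge0_ler_powR ?nnegrE ?(ltW r0)//.
  apply: le_trans (ler_norm_sum _ _ _) _; apply: ler_sum => i _.
  by rewrite normrM (ger0_norm (q0 i)).
have mE : m `^ r = m `^ (r - 1) * m.
  have [->|mn0] := eqVneq m 0; first by rewrite powR0 ?mulr0 ?gt_eqF.
  by rewrite -[X in _ * X]powRr1// -powRD ?subrK// mn0 implybT.
have young i : `|x i| * m `^ (r - 1) <= `|x i| `^ r / r + m `^ r * (1 - r^-1).
  have s0 : r - 1 != 0 by lra.
  have rn0 : r != 0 by lra.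
  have := @conjugate_powR R `|x i| (m `^ (r - 1)) r (r / (r - 1)).
  rewrite -powRrM mulrCA divff// mulr1 invf_div.
  have -> : (r - 1) / r = 1 - r^-1 by field.
  by apply; rewrite ?powR_ge0 ?divr_gt0 ?subr_gt0//; lra.
have : \sum_i q i * (`|x i| * m `^ (r - 1)) <=
    \sum_i q i * (`|x i| `^ r / r + m `^ r * (1 - r^-1)).
  by apply: ler_sum => i _; rewrite ler_wpM2l.
have -> : \sum_i q i * (`|x i| * m `^ (r - 1)) = m `^ r.
  by rewrite mE mulrC mulr_suml; apply: eq_bigr => i _; rewrite mulrA.
have -> : \sum_i q i * (`|x i| `^ r / r + m `^ r * (1 - r^-1)) =
    (\sum_i q i * `|x i| `^ r) / r + m `^ r * (1 - r^-1).
  rewrite -[X in _ = _ + X]mul1r -q1 !mulr_suml -big_split /=.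
  by apply: eq_bigr => i _; rewrite mulrDr mulrA.
set s := \sum_i _ => h.
have : m `^ r / r <= s / r by lra.
by rewrite ler_pM2r ?invr_gt0.
Qed.

(** Jensen's inequality on pairs, with weights [p_i w_ij] at the points
    [x_ij / p_i].  It produces the factors [p_i^(1 - r)], and
    [p_i^(1 - r) <= p_i^-1] is where [r <= 2] enters. *)
Lemma weighted_jensen_powR (R : realType) (I J : finType) (p : I -> R)
    (w x : I -> J -> R) (r : R) :
  1 < r <= 2 -> (forall i, 0 < p i <= 1) -> \sum_i p i = 1 ->
  (forall i j, 0 <= w i j) -> (forall i, \sum_j w i j = 1) ->
  `|\sum_i \sum_j w i j * x i j| `^ r <=
  \sum_i (p i)^-1 * \sum_j w i j * `|x i j| `^ r.
Proof.
move=> /andP[r1 r2] hp p1 w0 w1.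
have pn0 i : p i != 0 by have /andP[/gt_eqF-> _] := hp i.
have q0 (u : I * J) : 0 <= p u.1 * w u.1 u.2.
  by have /andP[/ltW ? _] := hp u.1; rewrite mulr_ge0.
have q1 : \sum_(u : I * J) p u.1 * w u.1 u.2 = 1.
  rewrite -(pair_bigA _ (fun i j => p i * w i j)) /= -p1.
  by apply: eq_bigr => i _; rewrite -mulr_sumr w1 mulr1.
have := jensen_powR (fun u => x u.1 u.2 / p u.1) r1 q0 q1.
rewrite -(pair_bigA _ (fun i j => p i * w i j * (x i j / p i))) /=.
rewrite -(pair_bigA _ (fun i j => p i * w i j * `|x i j / p i| `^ r)) /=.
have -> : \sum_i \sum_j p i * w i j * (x i j / p i) =
    \sum_i \sum_j w i j * x i j.
  by apply: eq_bigr => i _; apply: eq_bigr => j _; field; exact: pn0.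
move/le_trans; apply.
apply: ler_sum => i _; rewrite mulr_sumr; apply: ler_sum => j _.
have /andP[p0 ple1] := hp i.
have pV0 : 0 <= (p i)^-1 by rewrite invr_ge0 ltW.
have pr : p i * (p i)^-1 `^ r <= (p i)^-1.
  rewrite -ler_pdivlMl// -expr2 -powR_mulrn//.
  by apply: ler_powR => //; rewrite invf_ge1.
rewrite normrM (ger0_norm pV0) powRM//.
have -> : p i * w i j * (`|x i j| `^ r * (p i)^-1 `^ r) =
  (p i * (p i)^-1 `^ r) * (w i j * `|x i j| `^ r) by ring.
by rewrite ler_wpM2r// mulr_ge0 ?powR_ge0.
Qed.

(** * Operations that do not increase a unitarily invariant norm *)

Section UnitarilyInvariantNorm.
Variables (R : realType) (n : nat) (N : 'M[R[i]]_n -> R).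
Hypotheses (hN : is_norm N) (hNU : unitarily_invariant N).

Lemma norm_realZ (t : R) X : N (t%:C *: X) = `|t| * N X.
Proof.
case: hN => _ _ -> _; congr (_ * _).
by rewrite /Normc.normc /= expr0n addr0 sqrtr_sqr.
Qed.

Lemma norm_average_unitary (t : R) (U V X : 'M[R[i]]_n) :
  -1 <= t <= 1 -> U \is unitarymx -> V \is unitarymx ->
  N (((1 + t) / 2)%:C *: X + ((1 - t) / 2)%:C *: (U *m X *m V)) <= N X.
Proof.
move=> /andP[t0 t1] Uu Vu; have [_ _ _ ND] := hN.
apply: le_trans (ND _ _) _; rewrite !norm_realZ hNU// -mulrDl.
rewrite !ger0_norm; [|lra|lra].
have -> : (1 + t) / 2 + (1 - t) / 2 = 1 by field.
by rewrite mul1r.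
Qed.

Definition reflection (j : 'I_n) : 'M[R[i]]_n :=
  diag_mx (\row_k (-1) ^+ (k == j)).

Lemma reflection_unitary j : reflection j \is unitarymx.
Proof.
apply/unitarymxP/matrixP => a b; rewrite /reflection mul_diag_mx !mxE.
case: (eqVneq a b) => [->|_]; last by rewrite mulr0n rmorph0 mulr0.
by rewrite !mulr1n rmorphXn rmorphN1 -exprMn mulrNN mulr1 expr1n.
Qed.

(** Row by row: scaling row [j] by [t] is the average of the matrix and of its
    product with [reflection j], with weights [(1 + t) / 2] and
    [(1 - t) / 2]. *)
Lemma norm_scale_rows (t : 'I_n -> R) (X : 'M[R[i]]_n) :
  (forall j, -1 <= t j <= 1) -> N (\matrix_(a, b) ((t a)%:C * X a b)) <= N X.
Proof.
move=> t01.
(* The list is duplicate-free so that each row is scaled once. *)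
suff scale_in s : uniq s ->
    N (\matrix_(a, b) ((if a \in s then t a else 1)%:C * X a b)) <= N X.
  have := scale_in _ (enum_uniq 'I_n); congr (N _ <= _).
  by apply/matrixP => a b; rewrite !mxE mem_enum.
elim: s => [_|j s IHs /= /andP[js us]].
  rewrite le_eqVlt; apply/orP; left; apply/eqP; congr N.
  by apply/matrixP => a b; rewrite !mxE mul1r.
apply: le_trans (IHs us); set Y := \matrix_(a, b) _ in IHs *.
have unit1 : (1%:M : 'M[R[i]]_n) \is unitarymx.
  by apply/unitarymxP; rewrite trmx1 map_mx1 mulmx1.
apply: le_trans (norm_average_unitary Y (t01 j) (reflection_unitary j) unit1).
rewrite le_eqVlt; apply/orP; left; apply/eqP; congr N.
apply/matrixP => a b; rewrite mulmx1 mul_diag_mx !mxE in_cons.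
have [->|_] := eqVneq a j; rewrite /= ?(negPf js) ?expr0 ?expr1.
  by rewrite !mul1r mulN1r mulrN -mulrBl -rmorphB /=; congr (_%:C * _); lra.
have -> : (1 - t j) / 2 = 1 - (1 + t j) / 2 by lra.
by rewrite mul1r -mulrDl -rmorphD addrC subrK mul1r.
Qed.

(** Averaging with the conjugate by [reflection j] kills the entries [(a, b)]
    for which exactly one of [a], [b] is [j]; doing so for every [j] leaves the
    diagonal. *)
Lemma norm_pinching (X : 'M[R[i]]_n) : N (diag_mx (\row_j X j j)) <= N X.
Proof.
(* [Y s] is the result of the averagings for the indices in [s]. *)
pose Y s := \matrix_(a, b) (if all (fun j => (a == j) == (b == j)) s
  then X a b else 0).
have pinch s : N (Y s) <= N X.
  elim: s => [|j s IHs].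
    rewrite le_eqVlt; apply/orP; left; apply/eqP; congr N.
    by apply/matrixP => a b; rewrite !mxE.
  apply: le_trans IHs.
  have /norm_average_unitary : -1 <= (0 : R) <= 1 by lra.
  move=> /(_ _ _ (Y s) (reflection_unitary j) (reflection_unitary j)).
  apply: le_trans; rewrite le_eqVlt; apply/orP; left; apply/eqP; congr N.
  apply/matrixP => a b; rewrite mul_mx_diag mul_diag_mx !mxE /=.
  set Z := if all _ s then _ else _.
  have half : ((1 + 0) / 2)%:C + ((1 - 0) / 2)%:C = 1 :> R[i].
    by rewrite -rmorphD /= -[RHS]/(1%:C); congr (_%:C); lra.
  have halfB : ((1 + 0) / 2)%:C - ((1 - 0) / 2)%:C = 0 :> R[i].
    by rewrite -rmorphB /= -[RHS]/(0%:C); congr (_%:C); lra.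
  have -> : (if ((a == j) == (b == j)) && all (fun j0 => (a == j0) == (b == j0)) s
    then X a b else 0) = if (a == j) == (b == j) then Z else 0.
    by rewrite /Z; case: ((a == j) == (b == j)).
  by case: (a == j); case: (b == j) => /=;
    rewrite ?expr1 ?expr0 ?mul1r ?mulr1 ?mulN1r ?mulrN1 ?opprK ?mulrN
      -?mulrBl -?mulrDl ?half ?halfB ?mul1r ?mul0r.
have := pinch (enum 'I_n); congr (N _ <= _).
apply/matrixP => a b; rewrite !mxE.
have [->|ab] := eqVneq a b.
  by rewrite mulr1n ifT//; apply/allP => j _.
rewrite mulr0n ifF//; apply/negP => /allP/(_ a (mem_enum _ _)).
by rewrite eqxx (eq_sym b) (negPf ab).
Qed.

(** After pinching [X] to its diagonal [b], scale row [j] by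
    [a j / b j]; when [b j = 0] the ratio is [0], which is still right
    since then [a j = 0]. *)
Lemma norm_diag_le (a b : 'I_n -> R) (X : 'M[R[i]]_n) :
  (forall j, 0 <= a j <= b j) -> (forall j, X j j = (b j)%:C) ->
  N (diag_mx (\row_j (a j)%:C)) <= N X.
Proof.
move=> ab XE; apply: le_trans (norm_pinching X).
have ratio j : -1 <= a j / b j <= 1.
  have /andP[a0 aleb] := ab j.
  have q0 : 0 <= a j / b j by rewrite divr_ge0// (le_trans a0).
  apply/andP; split; first by lra.
  have [b0|b0] := eqVneq (b j) 0; first by rewrite b0 invr0 mulr0; lra.
  by rewrite ler_pdivrMr ?mul1r// lt_neqAle eq_sym b0 (le_trans a0).
have := norm_scale_rows (diag_mx (\row_j X j j)) ratio; congr (N _ <= _).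
apply/matrixP => j k; rewrite !mxE XE.
have [_|_] := eqVneq j k; last by rewrite !mulr0n mulr0.
rewrite !mulr1n -rmorphM /=; congr (_%:C).
have /andP[a0 aleb] := ab j.
have [b0|b0] := eqVneq (b j) 0; last by rewrite divfK.
by apply/eqP; rewrite b0 mulr0 eq_le; apply/andP; split=> //; rewrite -b0.
Qed.

End UnitarilyInvariantNorm.

(** * Diagonal entries in an orthonormal basis *)

Lemma hermsymmx_diagonalization (R : realType) (n : nat) (A : 'M[R[i]]_n) :
  A \is hermsymmx ->
  exists (U : 'M[R[i]]_n) (d : 'I_n -> R),
    U \is unitarymx /\ A = U^t* *m diag_mx (\row_j (d j)%:C) *m U.
Proof.
move=> hA; exists (spectralmx A), (fun j => complex.Re (spectral_diag A 0 j)).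
split; first exact: spectral_unitarymx.
rewrite [LHS](orthomx_spectralP (hermitian_normalmx hA)).
rewrite invmx_unitary ?spectral_unitarymx//; congr (_ *m diag_mx _ *m _).
apply/matrixP => i j; rewrite !mxE ord1.
by have /mxOverP/(_ 0 j)/complex_realP[x ->] := hermitian_spectral_diag_real hA.
Qed.

Lemma hermsymmx_sum (R : realType) (n : nat) (I : finType)
    (A : I -> 'M[R[i]]_n) :
  (forall i, A i \is hermsymmx) -> \sum_i A i \is hermsymmx.
Proof.
move=> hA; apply/is_hermitianmxP; rewrite expr0 scale1r raddf_sum map_mx_sum.
apply: eq_bigr => i _.
by have /is_hermitianmxP := hA i; rewrite expr0 scale1r.
Qed.

Lemma mxpowR_mxabs (R : realType) (n : nat) (U : 'M[R[i]]_n) (d : 'I_n -> R)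
    (r : R) :
  U \is unitarymx ->
  mxpowR (mxabs (U^t* *m diag_mx (\row_j (d j)%:C) *m U)) r =
  U^t* *m diag_mx (\row_j (`|d j| `^ r)%:C) *m U.
Proof.
move=> Uu.
have -> : mxabs (U^t* *m diag_mx (\row_j (d j)%:C) *m U) =
    U^t* *m diag_mx (\row_j ((\row_k `|d k|) 0 j)%:C) *m U.
  rewrite /mxabs.
  have -> : (U^t* *m diag_mx (\row_j (d j)%:C) *m U)^t* *m
      (U^t* *m diag_mx (\row_j (d j)%:C) *m U) =
      U^t* *m diag_mx (\row_j ((\row_k (d k ^+ 2)) 0 j)%:C) *m U.
    rewrite !trmx_mul !map_mxM trmxCK /= tr_diag_mx !mulmxA mulmxtVK//.
    congr (_ *m _); rewrite -!mulmxA; congr (_ *m _).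
    apply/matrixP => a b; rewrite mul_mx_diag !mxE.
    case: (eqVneq a b) => [->|_]; last by rewrite !mulr0n rmorph0 mul0r.
    by rewrite !mulr1n expr2 rmorphM conj_Creal ?complex_real.
  rewrite /mxpowR mxfunE//; congr (_ *m diag_mx _ *m _).
  apply/matrixP => a b; rewrite !mxE powR12_sqrt ?sqr_ge0//.
  by rewrite sqrtr_sqr.
rewrite /mxpowR mxfunE//; congr (_ *m diag_mx _ *m _).
by apply/matrixP => a b; rewrite !mxE.
Qed.

(** The weights are [w j k = |V j k|^2].  They are independent of [d], which
    lets one family serve both a Hermitian matrix and its functional calculus. *)
Lemma diag_entry_weights (R : realType) (n : nat) (V : 'M[R[i]]_n) :
  V \is unitarymx ->
  exists w : 'I_n -> 'I_n -> R,
    [/\ forall j k, 0 <= w j k,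
        forall j, \sum_k w j k = 1 &
        forall (d : 'I_n -> R) j,
          (V *m diag_mx (\row_k (d k)%:C) *m V^t*) j j =
          (\sum_k w j k * d k)%:C].
Proof.
move=> Vu; pose w j k := complex.Re (V j k) ^+ 2 + complex.Im (V j k) ^+ 2.
have wE (d : 'I_n -> R) j :
    (V *m diag_mx (\row_k (d k)%:C) *m V^t*) j j = (\sum_k w j k * d k)%:C.
  rewrite mul_mx_diag mxE rmorph_sum; apply: eq_bigr => k _.
  rewrite !mxE mulrAC rmorphM -normCK normc_def -rmorphXn sqr_sqrtr //.
  by rewrite addr_ge0 ?sqr_ge0.
exists w; split=> // [j k|j]; first by rewrite addr_ge0 ?sqr_ge0.
apply: complexI; have := wE (fun=> 1) j.
under eq_bigr do rewrite mulr1.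
move=> <-; have -> : diag_mx (\row_k 1%:C) = 1%:M :> 'M[R[i]]_n.
  by apply/matrixP => a b; rewrite !mxE.
by rewrite mulmx1 (unitarymxP Vu) mxE eqxx.
Qed.

Lemma diag_entry_spectral_weights (R : realType) (n : nat)
    (U A : 'M[R[i]]_n) (r : R) :
  U \is unitarymx -> A \is hermsymmx ->
  exists (w : 'I_n -> 'I_n -> R) (d : 'I_n -> R),
    [/\ forall j k, 0 <= w j k,
        forall j, \sum_k w j k = 1,
        forall j, (U *m A *m U^t*) j j = (\sum_k w j k * d k)%:C &
        forall j, (U *m mxpowR (mxabs A) r *m U^t*) j j =
          (\sum_k w j k * `|d k| `^ r)%:C].
Proof.
move=> Uu /hermsymmx_diagonalization[W [d [Wu ->]]].
have /diag_entry_weights[w [w0 w1 wE]] : U *m W^t* \is unitarymx.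
  by rewrite mul_unitarymx// trmxC_unitary.
exists w, d; split=> // j; rewrite ?mxpowR_mxabs// -wE.
all: by rewrite trmx_mul map_mxM trmxCK !mulmxA.
Qed.

(** * The norm inequality *)

Theorem corollary2p10 (R : realType) (n l : nat) (hn : (0 < n)%N)
    (hl : (0 < l)%N) (A : 'I_l -> 'M[R[i]]_n)
    (hA : forall i, A i \is hermsymmx)
    (N : 'M[R[i]]_n -> R) (hN : is_norm N) (hNU : unitarily_invariant N)
    (r : R) (hr : 1 < r <= 2)
    (p : 'I_l -> R) (hp : forall i, 0 < p i <= 1)
    (hp1 : \sum_(i < l) p i = 1) :
  N (mxpowR (mxabs (\sum_(i < l) A i)) r) <=
  N (\sum_(i < l) ((p i)^-1)%:C *: mxpowR (mxabs (A i)) r).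
Proof.
have [U [ev [Uu HE]]] := hermsymmx_diagonalization (hermsymmx_sum hA).
have Utu : U^t* \is unitarymx by rewrite trmxC_unitary.
have [w] := fin_all_exists
  (fun i => diag_entry_spectral_weights r Uu (hA i)).
case/fin_all_exists => d wd.
have w0 i j k : 0 <= w i j k by have [] := wd i.
have w1 i j : \sum_k w i j k = 1 by have [] := wd i.
have evE j : ev j = \sum_i \sum_k w i j k * d i k.
  apply: complexI; rewrite rmorph_sum.
  transitivity ((U *m (\sum_i A i) *m U^t*) j j).
    rewrite HE !mulmxA mulmxtVK// (unitarymxP Uu) mul1mx mxE eqxx mxE.
    by rewrite mulr1n.
  rewrite mulmx_sumr mulmx_suml summxE; apply: eq_bigr => i _.
  by have [_ _ ->] := wd i.
rewrite HE mxpowR_mxabs// hNU//.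
rewrite -[leRHS](hNU _ _ _ Uu Utu).
apply: (norm_diag_le hN hNU
  (b := fun j => \sum_i (p i)^-1 * \sum_k w i j k * `|d i k| `^ r)) => j.
  by rewrite powR_ge0 evE weighted_jensen_powR.
rewrite mulmx_sumr mulmx_suml summxE rmorph_sum; apply: eq_bigr => i _.
rewrite -scalemxAr -scalemxAl mxE rmorphM /=.
by have [_ _ _ ->] := wd i.
Qed.
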